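(* Let $p$ be a prime with $p\neq 2$, and let $n$ be a positive integer. Then $$Q_{np}(X)\equiv Q_p(X)^n\equiv \bigl(X^p-(-1)^{(p-1)/2}X\bigr)^n \pmod{np\,\mathbb{Z}_p[X]}.$$
   Context: $\mathbb{Z}_p$ denotes the ring of $p$-adic integers. The Meixner polynomials $Q_n(X)$, $n\ge 0$, are defined by their exponential generating function $$\frac{1}{\sqrt{1+t^2}}\exp(X\arctan t)=\sum_{n=0}^{\infty}Q_n(X)\frac{t^n}{n!},$$ as an identity of formal power series in $t$. *)

(* Defs.v *)
From HB Require Import structures.
From mathcomp Require Import all_boot all_order all_algebra.
From mathcomp Require Import mathcomp_extra boolp.

Set Implicit Arguments.
Unset Strict Implicit.
Unset Printing Implicit Defensive.

Import Order.TTheory GRing.Theory Num.Theory.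
Local Open Scope ring_scope.

(* The ring of p-adic integers, as the inverse limit of the Z/p^n: a p-adic   *)
(* integer is the sequence of its residues in [0, p^n[.                       *)
Record padic_seq (p : nat) := PadicSeq {
  padic_res :> nat -> nat;
  padic_resP : forall n, (padic_res n.+1 %% p ^ n)%N = padic_res n
}.

(* The primality proof is a phantom argument, which makes the integral domain *)
(* structure inferable from the type.                                         *)
Definition padic_int (p : nat) (p_pr : prime p) : Type := padic_seq p.

Section PadicIntegers.
Variables (p : nat) (p_pr : prime p).
Local Notation Zp := (padic_int p_pr).
Implicit Types x y z : Zp.

HB.instance Definition _ := gen_eqMixin Zp.
HB.instance Definition _ := gen_choiceMixin Zp.

Lemma padic_exp_gt0 n : (0 < p ^ n)%N.
Proof. by rewrite expn_gt0 prime_gt0. Qed.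

Lemma padicP x y : (forall n, x n = y n) -> x = y.
Proof.
case: x y => [f fP] [g gP] /= /funext fg; move: gP; rewrite -fg => gP.
by congr PadicSeq; exact: Prop_irrelevance.
Qed.

Lemma padic_modE x n : (x n %% p ^ n)%N = x n.
Proof. by rewrite -(padic_resP x n) modn_mod. Qed.

Lemma padic_modS x n : (x n.+1 = x n %[mod p ^ n])%N.
Proof. by rewrite padic_resP padic_modE. Qed.

Lemma padic_modD x n k : (x (n + k)%N = x n %[mod p ^ n])%N.
Proof.
elim: k => [|k IHk]; first by rewrite addn0.
rewrite -IHk addnS.
by rewrite -(modn_dvdm (x (n + k).+1) (dvdn_exp2l p (leq_addr k n))) padic_resP.
Qed.

Lemma padic_ofP (f : nat -> nat) :
  (forall n, f n.+1 = f n %[mod p ^ n])%N ->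
  forall n, ((f n.+1 %% p ^ n.+1) %% p ^ n)%N = (f n %% p ^ n)%N.
Proof. by move=> fP n; rewrite (modn_dvdm _ (dvdn_exp2l p (leqnSn n))). Qed.

Definition padic_of f fP : Zp := PadicSeq (@padic_ofP f fP).

Lemma padic_natP (a n : nat) : (a = a %[mod p ^ n])%N.
Proof. by []. Qed.

Lemma padic_addP x y n : (x n.+1 + y n.+1 = x n + y n %[mod p ^ n])%N.
Proof. by rewrite -modnDm !padic_modS modnDm. Qed.

Lemma padic_mulP x y n : (x n.+1 * y n.+1 = x n * y n %[mod p ^ n])%N.
Proof. by rewrite -modnMm !padic_modS modnMm. Qed.

Lemma padic_oppP x n :
  (p ^ n.+1 - x n.+1 = p ^ n - x n %[mod p ^ n])%N.
Proof.
have lt_x m : (x m <= p ^ m)%N.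
  by rewrite -(padic_modE x m) ltnW // ltn_pmod // padic_exp_gt0.
apply/eqP; rewrite -(eqn_modDr (x n)) subnK // -modnDmr -padic_modS modnDmr.
by rewrite subnK // modnn expnS modnMl.
Qed.

Definition padic_nat (a : nat) : Zp := padic_of (padic_natP a).
Definition padic_add x y : Zp := padic_of (padic_addP x y).
Definition padic_mul x y : Zp := padic_of (padic_mulP x y).
Definition padic_opp x : Zp := padic_of (padic_oppP x).

Lemma padic_addA : associative padic_add.
Proof. by move=> x y z; apply: padicP => n /=; rewrite modnDmr modnDml addnA. Qed.

Lemma padic_addC : commutative padic_add.
Proof. by move=> x y; apply: padicP => n /=; rewrite addnC. Qed.

Lemma padic_add0 : left_id (padic_nat 0) padic_add.
Proof. by move=> x; apply: padicP => n /=; rewrite mod0n add0n padic_modE. Qed.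

Lemma padic_addN : left_inverse (padic_nat 0) padic_opp padic_add.
Proof.
move=> x; apply: padicP => n /=; rewrite modnDml subnK ?modnn ?mod0n //.
by rewrite -(padic_modE x n) ltnW // ltn_pmod // padic_exp_gt0.
Qed.

HB.instance Definition _ := GRing.isZmodule.Build Zp
  padic_addA padic_addC padic_add0 padic_addN.

Lemma padic_mulA : associative padic_mul.
Proof. by move=> x y z; apply: padicP => n /=; rewrite modnMmr modnMml mulnA. Qed.

Lemma padic_mulC : commutative padic_mul.
Proof. by move=> x y; apply: padicP => n /=; rewrite mulnC. Qed.

Lemma padic_mul1 : left_id (padic_nat 1) padic_mul.
Proof. by move=> x; apply: padicP => n /=; rewrite modnMml mul1n padic_modE. Qed.

Lemma padic_mulDl : left_distributive padic_mul padic_add.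
Proof.
by move=> x y z; apply: padicP => n /=; rewrite modnMml modnDm mulnDl.
Qed.

Lemma padic_oner_neq0 : padic_nat 1 != padic_nat 0.
Proof.
apply/eqP => /(congr1 (fun x : Zp => x 1)) /=.
by rewrite expn1 mod0n modn_small // prime_gt1.
Qed.

HB.instance Definition _ := GRing.Zmodule_isComNzRing.Build Zp
  padic_mulA padic_mulC padic_mul1 padic_mulDl padic_oner_neq0.

Definition padic_unit : pred Zp := fun x => `[< exists y : Zp, y * x = 1 >].
Definition padic_inv x : Zp :=
  if pselect (exists y : Zp, y * x = 1) is left h then projT1 (cid h) else x.

Lemma padic_mulVx : {in padic_unit, left_inverse 1 padic_inv *%R}.
Proof.
move=> x /asboolP xU; rewrite /padic_inv.
by case: pselect => // h; case: (cid h).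
Qed.

Lemma padic_unitPl x y : y * x = 1 -> padic_unit x.
Proof. by move=> yx1; apply/asboolP; exists y. Qed.

Lemma padic_invr_out : {in [predC padic_unit], padic_inv =1 id}.
Proof.
move=> x /= xNU; rewrite /padic_inv; case: pselect => // h.
by move: xNU; rewrite inE => /negP[]; apply/asboolP.
Qed.

HB.instance Definition _ := GRing.ComNzRing_hasMulInverse.Build Zp
  padic_mulVx padic_unitPl padic_invr_out.

Lemma padic_neq0 x : x != 0 -> exists n, ~~ (p ^ n %| x n)%N.
Proof.
move=> xn0; apply: contrapT => h; case/eqP: xn0; apply: padicP => n /=.
rewrite mod0n -(padic_modE x n); apply/eqP; rewrite -/(dvdn _ _).
by apply/negPn/negP => xn; apply: h; exists n.
Qed.

Lemma padic_integral x y : x * y = 0 -> (x == 0) || (y == 0).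
Proof.
move=> xy0; apply/norP => -[/padic_neq0[a xa] /padic_neq0[b yb]].
have dvd_le (z : Zp) c k : (p ^ c %| z (c + k)%N)%N = (p ^ c %| z c)%N.
  by rewrite /dvdn padic_modD.
rewrite -(dvd_le x a b) in xa; rewrite -(dvd_le y b a) addnC in yb.
have x_gt0 : (0 < x (a + b))%N by case: (x _) xa; rewrite ?dvdn0.
have y_gt0 : (0 < y (a + b))%N by case: (y _) yb; rewrite ?dvdn0.
rewrite pfactor_dvdn // -ltnNge in xa; rewrite pfactor_dvdn // -ltnNge in yb.
have /(congr1 (fun z : Zp => z (a + b)%N)) /= := xy0.
rewrite mod0n => /eqP; rewrite -/(dvdn _ _) pfactor_dvdn ?muln_gt0 ?x_gt0 //.
by rewrite lognM // leqNgt -addnS leq_add // ltnW.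
Qed.

HB.instance Definition _ := GRing.ComUnitRing_isIntegral.Build Zp
  padic_integral.

End PadicIntegers.

Notation "''Z_[' p_pr ]" := (padic_int p_pr) (format "''Z_[' p_pr ]") : type_scope.
(* The field of p-adic numbers. *)
Notation "''Q_[' p_pr ]" := {fraction 'Z_[p_pr]}
  (format "''Q_[' p_pr ]") : type_scope.

(* f = g modulo m Z_p[X], where f and g are viewed in Q_p[X]. *)
Definition eq_mod_padic (p : nat) (p_pr : prime p) (m : nat)
    (f g : {poly rat}) : Prop :=
  exists h : {poly 'Z_[p_pr]},
    map_poly (ratr : rat -> 'Q_[p_pr]) (f - g)
    = m%:R *: map_poly (@tofrac 'Z_[p_pr]) h.

(* Formal power series in t over a ring, given by their coefficients. *)
Definition fps (A : Type) := nat -> A.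

Definition fps_one (A : pzRingType) : fps A := fun n => (n == 0%N)%:R.

Definition fps_mul (A : pzRingType) (f g : fps A) : fps A :=
  fun n => \sum_(i < n.+1) f i * g (n - i)%N.

Definition fps_pow (A : pzRingType) (f : fps A) (k : nat) : fps A :=
  iter k (fps_mul f) (fps_one A).

(* The composite a(f(t)) = \sum_k a_k f(t)^k. When f has no constant term,    *)
(* f(t)^k has order at least k, so that only the terms with k <= n contribute *)
(* to the coefficient of t^n.                                                 *)
Definition fps_comp (A : algType rat) (a : fps rat) (f : fps A) : fps A :=
  fun n => \sum_(k < n.+1) a k *: fps_pow f k n.

(* exp u *)
Definition exp_fps : fps rat := fun k => (k`!%:R)^-1.

(* (1 + u)^c, with the binomial coefficients c (c - 1) ... (c - k + 1) / k! *)
Definition binom_fps (c : rat) : fps rat :=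
  fun k => (\prod_(i < k) (c - i%:R)) / k`!%:R.

(* arctan t = t - t^3/3 + t^5/5 - ... *)
Definition arctan_fps : fps rat :=
  fun n => if odd n then (-1) ^+ n./2 / n%:R else 0.

(* (1 + t^2)^(-1/2) exp(X arctan t) *)
Definition meixner_egf : fps {poly rat} :=
  fps_mul
    (fps_comp (binom_fps (- 2%:R^-1)) (fun n => (n == 2%N)%:R))
    (fps_comp exp_fps (fun n => (arctan_fps n) *: 'X)).

Definition meixner (n : nat) : {poly rat} := n`!%:R *: meixner_egf n.

(* Main.v *)
From mathcomp Require Import all_boot all_order all_algebra all_field.
From mathcomp Require Import ring zify.
From mathcomp Require Import boolp.
Require Import Defs.
Set Implicit Arguments.
Unset Strict Implicit.
Unset Printing Implicit Defensive.
Import GRing.Theory.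
Local Open Scope ring_scope.

(** The Meixner polynomials satisfy Q_(n+1) = X Q_n - n^2 Q_(n-1)
    ([meixner_contin]), because their generating function F is the solution of
    (1 + t^2) F' = (X - t) F ([meixner_egf_ode]). In particular they have integral
    coefficients, and the cofactor of the p-part of n p is invertible in Z_p, so
    both congruences are congruences in Z[X] modulo p^(s+1), where s is the
    p-adic valuation of n ([eq_mod_padic_int]).

    For the first congruence, the recurrence has the coefficient N^2 at the
    index N. Modulo N^2 it therefore starts afresh at every multiple of N, and
    Q_(aN) is the product over b < a of shifted polynomials Q_N + b N D with one
    and the same D ([contin_mul]):
      Q_(aN) = Q_N^a + 'C(a, 2) N D Q_N^(a-1)  modulo N^2.
    With N = p^k, k >= 1, and a = p odd, p divides 'C(p, 2), so Q_(pN) = Q_N^p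
    modulo p N; by induction Q_(p^(s+1)) = Q_p^(p^s) modulo p^(s+1)
    ([contin_prime_power]). With N = p^(s+1) and a = n / p^s the formula gives
    Q_(np) = Q_N^a modulo N, which concludes ([contin_mul_prime]).

    For the second congruence it suffices to know Q_p modulo p, since the powers
    lift ([eqmod_exp]). The polynomials q_n(X) = i^(-n) Q_n(iX), which satisfy
    q_(n+1) = X q_n + n^2 q_(n-1), have a difference equation in X
    ([contin_add2]) which shows that q_p is periodic modulo p and vanishes on
    F_p. Being monic of degree p, it is X^p - X modulo p ([contin_Fp]), and
    going back to Q_p only changes signs ([contin_prime_int]). *)

Lemma ind2 (P : nat -> Prop) : P 0%N -> P 1%N ->
  (forall n, P n -> P n.+1 -> P n.+2) -> forall n, P n.
Proof.
move=> P0 P1 PS n; suff: P n /\ P n.+1 by case.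
by elim: n => [|n [Pn PSn]]; split=> //; apply: PS.
Qed.

(** * Continuants with quadratic coefficients *)

Section Continuant.
Variable R : comNzRingType.
Implicit Types x e c : R.

(** The continuant of the tridiagonal matrix with diagonal entries x and with
    products of opposite off-diagonal entries - e (c + k)^2, k >= 1. For
    x = X, e = -1 and c = 0 this is the Meixner polynomial Q_n; a nonzero c
    shifts the recurrence, and e = 1 gives the polynomials i^(-n) Q_n(iX). *)
Fixpoint contin x e c n : R :=
  match n with
  | 0 => 1
  | n'.+1 => match n' with
             | 0 => x
             | n''.+1 => x * contin x e c n' + e * (c + n'%:R) ^+ 2 * contin x e c n''
             end
  end.

Lemma continSS x e c n : contin x e c n.+2 =
  x * contin x e c n.+1 + e * (c + n.+1%:R) ^+ 2 * contin x e c n.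
Proof. by []. Qed.

(** The predecessor n.-1 = 0 at n = 0 is harmless: its coefficient is 0. *)
Lemma contin0S x e n : contin x e 0 n.+1 =
  x * contin x e 0 n + e * n%:R ^+ 2 * contin x e 0 n.-1.
Proof. by case: n => [|n]; [rewrite /= ; ring | rewrite continSS add0r]. Qed.

(** At the index N the recurrence has the coefficient N^2, so modulo N^2 it
    starts afresh there, with the shift N. *)
Lemma contin_add x e N j : exists w,
  contin x e 0 (N + j) = contin x e 0 N * contin x e N%:R j + N%:R ^+ 2 * w.
Proof.
elim/ind2: j => [||j [w Ew] [w' Ew']].
- by exists 0; rewrite addn0 /=; ring.
- by exists (e * contin x e 0 N.-1); rewrite addn1 contin0S /=; ring.
exists (x * w' + e * (N + j.+1)%:R ^+ 2 * w).
by rewrite !addnS continSS -!addnS Ew Ew' continSS; ring.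
Qed.

(** First order Taylor expansion in the shift. D is the derivative at c = 0; as
    it serves for all c at once, the linear terms of several shifts add up. *)
Lemma contin_shift x e j : exists D, forall c, exists w,
  contin x e c j = contin x e 0 j + c * D + c ^+ 2 * w.
Proof.
elim/ind2: j => [||j [D ED] [D' ED']].
- by exists 0 => c; exists 0 => /=; ring.
- by exists 0 => c; exists 0 => /=; ring.
exists (x * D' + e * (j.+1%:R ^+ 2 * D + j.+1%:R *+ 2 * contin x e 0 j)) => c.
have [w Ew] := ED c; have [w' Ew'] := ED' c.
exists (x * w' + e * ((c + j.+1%:R) ^+ 2 * w + contin x e 0 j +
                      (c + j.+1%:R *+ 2) * D)).
by rewrite !continSS Ew Ew'; ring.
Qed.

(** Modulo N^2, the continuant of length a N is the product over b < a of the
    continuants of length N with shift b N, that is of the q + b N D where q is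
    the one without shift; the linear terms add up to
    (0 + 1 + ... + (a-1)) N D q^(a-1). *)
Lemma contin_mul x e N : exists D, forall a, exists w,
  contin x e 0 (a * N) = contin x e 0 N ^+ a
    + 'C(a, 2)%:R * N%:R * D * contin x e 0 N ^+ a.-1 + N%:R ^+ 2 * w.
Proof.
have [D ED] := contin_shift x e N; exists D; elim=> [|a [w Ew]].
  by exists 0; rewrite mul0n bin0n /= expr0; ring.
have [w' Ew'] := contin_add x e (a * N) N.
have [w'' Ew''] := ED (a * N)%:R.
rewrite mulSn addnC Ew' Ew'' Ew binS bin1.
(* For a = 0 the exponent a.-1 is truncated, but 'C(0, 2) = 0. *)
case: a {Ew Ew' Ew''} => [|a] /=.
  by exists (w * contin x e 0 N); rewrite bin0n mul0n addn0 expr1 /=; ring.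
set q := contin x e 0 N; set C := 'C(a.+1, 2).
exists (w * q + (q ^+ a.+1 + C%:R * N%:R * D * q ^+ a + N%:R ^+ 2 * w) *
         a.+1%:R ^+ 2 * w'' + w * N%:R * a.+1%:R * D +
         C%:R * D ^+ 2 * q ^+ a * a.+1%:R + a.+1%:R ^+ 2 * w').
rewrite !exprS; ring.
Qed.

End Continuant.

Lemma contin_morph (R S : comNzRingType) (f : {rmorphism R -> S}) x e c n :
  f (contin x e c n) = contin (f x) (f e) (f c) n.
Proof.
elim/ind2: n => [||n IH IH']; rewrite ?rmorph1 //.
by rewrite !continSS !(rmorphD, rmorphM, rmorphXn, rmorph_nat) IH IH'.
Qed.

(** * Congruences modulo prime powers *)

Lemma pfactor_split p n : prime p -> (0 < n)%N ->
  exists2 m, n = (m * p ^ logn p n)%N & coprime m p.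
Proof.
move=> p_pr n_gt0; exists (n`_p^')%N; first by rewrite -p_part mulnC partnC.
by rewrite coprime_sym prime_coprime // -p'natE // part_pnat.
Qed.

Section Congruence.
Variable R : comNzRingType.
Implicit Types d x y z : R.

Definition eqmod d x y := exists z, x = y + d * z.

Lemma eqmod_refl d x : eqmod d x x.
Proof. by exists 0; ring. Qed.

Lemma eqmod_trans d x y z : eqmod d x y -> eqmod d y z -> eqmod d x z.
Proof. by case=> u -> [v ->]; exists (u + v); ring. Qed.

Lemma eqmodM d x y x' y' : eqmod d x y -> eqmod d x' y' -> eqmod d (x * x') (y * y').
Proof. by case=> u -> [v ->]; exists (u * y' + y * v + d * u * v); ring. Qed.

Lemma eqmodX d x y a : eqmod d x y -> eqmod d (x ^+ a) (y ^+ a).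
Proof.
move=> xy; elim: a => [|a IH]; first exact: eqmod_refl.
by rewrite !exprS; apply: eqmodM.
Qed.

(** In (y + d z)^a - y^a the linear term carries the factor a d and all the
    others d^2. *)
Lemma eqmod_lift (a k : nat) x y :
  eqmod (a ^ k.+1)%:R x y -> eqmod (a ^ k.+2)%:R (x ^+ a) (y ^+ a).
Proof.
case=> z ->; set d := (a ^ k.+1)%:R.
have [w ->] : exists w, (y + d * z) ^+ a =
    y ^+ a + a%:R * d * z * y ^+ a.-1 + d ^+ 2 * w.
  elim: {1 2 3 4}a => [|b [w Ew]]; first by exists 0; rewrite !expr0; ring.
  rewrite exprS Ew; case: b {Ew} => [|b] /=; first by exists (w * (y + d * z)); ring.
  exists (y * w + b.+1%:R * z ^+ 2 * y ^+ b + d * z * w).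
  by rewrite !exprS; ring.
exists (z * y ^+ a.-1 + (a ^ k)%:R * w).
by rewrite /d !expnS !natrM; ring.
Qed.

Lemma eqmod_lift_iter (a k : nat) x y :
  eqmod a%:R x y -> eqmod (a ^ k.+1)%:R (x ^+ (a ^ k)) (y ^+ (a ^ k)).
Proof.
move=> xy; elim: k => [|k IH]; first by rewrite expn1 !expr1.
by rewrite (expnSr a k) !exprM; apply: eqmod_lift.
Qed.

Lemma contin_mul_eqmod x e a m : eqmod a%:R (contin x e 0 (m * a)) (contin x e 0 a ^+ m).
Proof.
have [D /(_ m)[w ->]] := contin_mul x e a.
by exists ('C(m, 2)%:R * D * contin x e 0 a ^+ m.-1 + a%:R * w); ring.
Qed.

(** With N = p^(k+1) the correction term of [contin_mul] for a = p is divisible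
    by 'C(p, 2) N, hence by p N since p is odd, and N^2 is divisible by p N;
    so the continuant of length p N is the p-th power of the one of length N
    modulo p N, and the congruence lifts from k to k + 1. *)
Lemma contin_prime_power x e p k : prime p -> p <> 2%N ->
  eqmod (p ^ k.+1)%:R (contin x e 0 (p ^ k.+1)) (contin x e 0 p ^+ (p ^ k)).
Proof.
move=> p_pr p_neq2; elim: k => [|k IH].
  by rewrite !expn1 expr1; apply: eqmod_refl.
apply: (@eqmod_trans _ _ (contin x e 0 (p ^ k.+1) ^+ p)); last first.
  by rewrite {2}(expnSr p k) exprM; apply: eqmod_lift.
have p_gt2 : (2 < p)%N by rewrite ltn_neqAle prime_gt1 // andbT eq_sym; apply/eqP.
have /dvdnP[q Eq] : (p %| 'C(p, 2))%N by rewrite prime_dvd_bin.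
rewrite {2}(expnS p k.+1).
have [D /(_ p)[w ->]] := contin_mul x e (p ^ k.+1)%N.
exists (q%:R * D * contin x e 0 (p ^ k.+1) ^+ p.-1 + (p ^ k)%:R * w).
by rewrite Eq !expnS !natrM; ring.
Qed.

Lemma eqmod_exp p n x y : prime p -> (0 < n)%N -> eqmod p%:R x y ->
  eqmod (p ^ (logn p n).+1)%:R (x ^+ n) (y ^+ n).
Proof.
move=> p_pr n_gt0 xy; have [m Em _] := pfactor_split p_pr n_gt0.
by rewrite {2 3}Em mulnC !exprM; apply/eqmodX/eqmod_lift_iter.
Qed.

Lemma contin_mul_prime x e p n : prime p -> p <> 2%N -> (0 < n)%N ->
  eqmod (p ^ (logn p n).+1)%:R (contin x e 0 (n * p)) (contin x e 0 p ^+ n).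
Proof.
move=> p_pr p_neq2 n_gt0; set s := logn p n.
have [m Em _] := pfactor_split p_pr n_gt0.
rewrite {1 2}Em -mulnA -expnSr.
apply: eqmod_trans (contin_mul_eqmod _ _ _ _) _.
by rewrite mulnC exprM; apply/eqmodX/contin_prime_power.
Qed.

End Congruence.

(** * The Meixner polynomial of prime index modulo p *)

(** The difference equation q_n(x + 2) - q_n(x) = n (q_(n-1)(x + 2) +
    q_(n-1)(x)). It reflects (1 - t) G_(x+2) = (1 + t) G_x for the generating
    function G_x = (1 - t^2)^(-1/2) ((1 + t) / (1 - t))^(x/2) of the q_n / n!. *)
Lemma contin_add2 (R : comNzRingType) (x : R) n :
  contin (x + 2%:R) 1 0 n.+1 - contin x 1 0 n.+1 =
  n.+1%:R * (contin (x + 2%:R) 1 0 n + contin x 1 0 n).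
Proof.
(* The series H = (1 - t) G_(x+2) - (1 + t) G_x satisfies (1 - t^2) H' =
   (x + 1) H, so its coefficients obey a linear recurrence with zero start. *)
apply/eqP; rewrite -subr_eq0; apply/eqP; elim/ind2: n => [||n IH IH'].
- rewrite /=; ring.
- rewrite /=; ring.
transitivity ((x + 1) *
   (contin (x + 2%:R) 1 0 n.+2 - contin x 1 0 n.+2 -
     n.+2%:R * (contin (x + 2%:R) 1 0 n.+1 + contin x 1 0 n.+1)) +
   n.+2%:R * n.+1%:R * (contin (x + 2%:R) 1 0 n.+1 - contin x 1 0 n.+1 -
     n.+1%:R * (contin (x + 2%:R) 1 0 n + contin x 1 0 n))).
  rewrite !continSS; ring.
by rewrite IH IH'; ring.
Qed.

Lemma contin_odd0 (R : comNzRingType) (e : R) n : odd n -> contin 0 e 0 n = 0.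
Proof.
elim/ind2: n => // n IH _; rewrite continSS /= negbK => /IH ->; ring.
Qed.

(** Modulo p the difference equation says that q_p is invariant under x |-> x + 2,
    and q_p(0) = 0 because p is odd; every element of F_p is a multiple of 2. *)
Lemma contin_root_Fp p (x : 'F_p) : prime p -> p <> 2%N -> contin x 1 0 p = 0.
Proof.
move=> p_pr p_neq2.
have p_odd : odd p by case/even_prime: (p_pr).
have p0 : p%:R = 0 :> 'F_p by exact: pchar_Fp_0.
have n20 : 2%:R != 0 :> 'F_p.
  rewrite -(dvdn_pcharf (pchar_Fp p_pr)) dvdn_prime2 //; exact/eqP.
rewrite (_ : x = 2%:R * (x / 2%:R)); last by rewrite mulrC divfK.
rewrite -[x / _]natr_Zp; elim: (nat_of_ord _) => [|k IH].
  by rewrite mulr0 contin_odd0.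
rewrite -[RHS]IH; have := contin_add2 (2%:R * k%:R : 'F_p) p.-1.
rewrite prednK ?prime_gt0 // p0 mul0r => /eqP; rewrite subr_eq0 => /eqP <-.
by rewrite -[k.+1]addn1 natrD mulrDr mulr1.
Qed.

Section Coefficients.
Variables (R : comNzRingType) (b : R).

Lemma contin_coefSS n k : (contin 'X b%:P 0 n.+2)`_k =
  (if k is k'.+1 then (contin 'X b%:P 0 n.+1)`_k' else 0)
  + b * n.+1%:R ^+ 2 * (contin 'X b%:P 0 n)`_k.
Proof.
rewrite continSS add0r coefD coefXM -polyC_natr -polyC_exp -polyCM coefCM.
by case: k.
Qed.

Lemma contin_coef_ge n k : (n <= k)%N -> (contin 'X b%:P 0 n)`_k = (k == n)%:R.
Proof.
elim/ind2: n k => [||n IH IH'] k nk.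
- by rewrite coef1.
- by rewrite coefX.
rewrite contin_coefSS (IH _ (ltnW (ltnW nk))).
by case: k nk => // k nk; rewrite IH' // eqSS (gtn_eqF (ltnW nk)) mulr0 addr0.
Qed.

End Coefficients.

(** Q_n(X) = i^n q_n(X / i), expressed on coefficients so as to avoid i. *)
Lemma contin_coef_sign (R : comNzRingType) n k : (k <= n)%N ->
  (contin 'X (-1)%:P 0 n : {poly R})`_k =
  (-1) ^+ (n - k)./2 * (contin 'X 1%:P 0 n)`_k.
Proof.
elim/ind2: n k => [||n IH IH'] k kn.
- by rewrite mul1r.
- by case: k kn => [|[|]] //= _; rewrite coefX /= ?mulr0 ?mul1r.
rewrite !contin_coefSS.
have IH2 : (-1) * (contin 'X (-1)%:P 0 n : {poly R})`_k =
    (-1) ^+ (n.+2 - k)./2 * (contin 'X 1%:P 0 n)`_k.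
  case: (leqP k n) => [kn'|nk]; first by rewrite IH // !subSn ?leqW // exprS mulrA.
  by rewrite !contin_coef_ge ?(ltnW nk) // gtn_eqF // !mulr0.
rewrite mulrAC IH2; case: k kn {IH2} => [|k] kn; last rewrite IH' // subSS; ring.
Qed.

(** q_p is monic of degree p and vanishes on the whole of F_p. *)
Lemma contin_Fp p : prime p -> p <> 2%N ->
  contin 'X 1%:P 0 p = 'X^p - 'X :> {poly 'F_p}.
Proof.
move=> p_pr p_neq2; set q := contin _ _ _ _.
have q_coef k : (p <= k)%N -> q`_k = (k == p)%:R by exact: contin_coef_ge.
have qp : q`_p = 1 by rewrite q_coef // eqxx.
have size_q : size q = p.+1.
  apply/eqP; rewrite eqn_leq; apply/andP; split.
    by apply/leq_sizeP => k pk; rewrite q_coef ?(ltnW pk) // gtn_eqF.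
  by rewrite ltnNge; apply/negP => /leq_sizeP/(_ p (leqnn _))/eqP; rewrite qp oner_eq0.
have -> : 'X^p - 'X = \prod_x ('X - x%:P) :> {poly 'F_p}.
  by rewrite -finField_genPoly card_Fp.
rewrite [LHS](@all_roots_prod_XsubC _ _ (enum 'F_p)).
- by rewrite lead_coefE size_q qp scale1r big_enum.
- by rewrite size_q -cardE card_Fp.
- apply/allP => x _; rewrite rootE -horner_evalE (contin_morph (horner_eval x)).
  by rewrite /= /horner_eval hornerX hornerC horner0 contin_root_Fp.
- by rewrite uniq_rootsE enum_uniq.
Qed.

Lemma contin_prime_int p : prime p -> p <> 2%N ->
  eqmod p%:R (contin 'X (-1) 0 p : {poly int}) ('X^p - (-1) ^+ ((p - 1) %/ 2) *: 'X).
Proof.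
move=> p_pr p_neq2.
pose d : {poly int} := contin 'X (-1) 0 p - ('X^p - (-1) ^+ ((p - 1) %/ 2) *: 'X).
suff dvd_d k : (p %| d`_k)%Z.
  exists (\poly_(k < size d) (d`_k %/ p)%Z).
  apply/eqP; rewrite addrC -subr_eq -/d; apply/eqP/polyP => k.
  rewrite mulr_natl coefMn coef_poly; case: ltnP => dk.
    by rewrite -[RHS]mulr_natr natz divzK.
  by rewrite mul0rn nth_default.
rewrite (dvdz_pcharf (pchar_Fp p_pr)) -coef_map.
pose qF (e : 'F_p) := contin 'X e%:P 0 p.
have -> : map_poly intr d = qF (-1) - ('X^p - (-1) ^+ ((p - 1) %/ 2) *: 'X).
  rewrite /d !rmorphB /= (contin_morph (map_poly intr)) map_polyXn map_polyZ /=.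
  by rewrite rmorphXn !rmorphN !rmorph1 map_polyX rmorph0 /qF polyCN polyC1.
have p_gt1 := prime_gt1 p_pr.
rewrite coefB subr_eq0 /qF !(coefB, coefXn, coefZ, coefX); apply/eqP.
case: (leqP k p) => [kp|pk]; last first.
  rewrite (contin_coef_ge _ (ltnW pk)) (gtn_eqF pk) (gtn_eqF (ltn_trans p_gt1 pk)).
  by rewrite mulr0 subr0.
rewrite (contin_coef_sign _ kp) (contin_Fp p_pr p_neq2) coefB coefXn coefX.
have [->|_] := eqVneq k p.
  by rewrite subnn (gtn_eqF p_gt1) mulr0 subr0 mul1r.
have [->|_] := eqVneq k 1%N; last by rewrite subr0 !mulr0 subr0.
by rewrite divn2 !sub0r mulrN.
Qed.

(** * From the generating function to the recurrence *)

Section Fps.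
Variable A : comNzRingType.
Implicit Types (f g h : fps A) (P Q : {poly A}).

(** Equalities of power series are proved by comparing both sides with
    polynomials up to a given degree, where the ring structure and the
    derivation are already available. *)
Definition agree n P f := forall i, (i <= n)%N -> P`_i = f i.

Lemma agree_mul n P Q f g : agree n P f -> agree n Q g -> agree n (P * Q) (fps_mul f g).
Proof.
move=> Pf Qg i le_in; rewrite coefM; apply: eq_bigr => j _.
by rewrite Pf ?Qg // (leq_trans _ le_in) ?leq_subr // -ltnS.
Qed.

Lemma agree_pow n P f k : agree n P f -> agree n (P ^+ k) (fps_pow f k).
Proof.
move=> Pf; elim: k => [|k IH]; first by move=> i _; rewrite expr0 coef1.
by rewrite exprS; apply: agree_mul.
Qed.

Definition fps_trunc n f : {poly A} := \poly_(i < n.+1) f i.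

Lemma fps_truncP n f : agree n (fps_trunc n f) f.
Proof. by move=> i; rewrite coef_poly ltnS => ->. Qed.

Definition fps_deriv f : fps A := fun n => f n.+1 *+ n.+1.

Lemma agree_deriv n P f : agree n.+1 P f -> agree n P^`() (fps_deriv f).
Proof. by move=> Pf i le_in; rewrite coef_deriv Pf. Qed.

Lemma fps_mul_poly P f n : fps_mul (fun i => P`_i) f n = (P * fps_trunc n f)`_n.
Proof.
by rewrite (agree_mul (f := fun i => P`_i) (fun i _ => erefl) (@fps_truncP n f)).
Qed.

Lemma fps_mul_sqr1 f n : fps_mul (fun i => (1 + 'X^2 : {poly A})`_i) f n =
  f n + (if n is n'.+2 then f n' else 0).
Proof.
rewrite fps_mul_poly mulrDl mul1r coefD coefXnM fps_truncP //; congr (_ + _).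
case: n => [|[|n]] //=; rewrite !subSS subn0 fps_truncP //; lia.
Qed.

Lemma fps_mul_linear (a b : A) f n :
  fps_mul (fun i => (a%:P + b *: 'X)`_i) f n =
  a * f n + b * (if n is n'.+1 then f n' else 0).
Proof.
rewrite fps_mul_poly mulrDl coefD coefCM -scalerAl coefZ coefXM fps_truncP //.
by case: n => [|n] //=; rewrite fps_truncP.
Qed.

Lemma fps_mulDl f g h :
  fps_mul (fun n => f n + g n) h = fun n => fps_mul f h n + fps_mul g h n.
Proof.
apply/funext => n; rewrite /fps_mul -big_split; apply: eq_bigr => i _.
by rewrite mulrDl.
Qed.

Lemma agree_low m n P f : (m <= n)%N -> agree n P f -> agree m P f.
Proof. by move=> mn Pf i im; apply/Pf/(leq_trans im). Qed.

Lemma fps_mulC f g : fps_mul f g = fps_mul g f.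
Proof.
apply/funext => n; rewrite -(agree_mul (@fps_truncP n f) (@fps_truncP n g)) //.
by rewrite mulrC (agree_mul (@fps_truncP n g) (@fps_truncP n f)).
Qed.

Lemma fps_mulA f g h : fps_mul f (fps_mul g h) = fps_mul (fps_mul f g) h.
Proof.
apply/funext => n; have [F G H] := And3 (@fps_truncP n f) (@fps_truncP n g) (@fps_truncP n h).
by rewrite -(agree_mul F (agree_mul G H)) // mulrA (agree_mul (agree_mul F G) H).
Qed.

Lemma fps_derivM f g n : fps_deriv (fps_mul f g) n =
  fps_mul (fps_deriv f) g n + fps_mul f (fps_deriv g) n.
Proof.
have [F G] := (@fps_truncP n.+1 f, @fps_truncP n.+1 g).
rewrite -(agree_deriv (agree_mul F G)) // derivM coefD.
rewrite (agree_mul (agree_deriv F) (agree_low _ G)) //.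
by rewrite (agree_mul (agree_low _ F) (agree_deriv G)).
Qed.

Lemma coef_exp_lt P k i : P`_0 = 0 -> (i < k)%N -> (P ^+ k)`_i = 0.
Proof.
move=> P0; elim: k i => // k IH i ik.
rewrite exprS coefM big_ord_recl P0 mul0r add0r big1 // => j _.
rewrite IH ?mulr0 // lift0; case: j => j /= ji; lia.
Qed.

End Fps.

Section FpsComp.
Implicit Types (f : fps {poly rat}) (P : {poly {poly rat}}).

(** A power P^k of a polynomial without constant term has no coefficient below
    degree k, so the finite sum may run up to any m >= n. *)
Lemma agree_comp n m (a : fps rat) P f : (n <= m)%N -> f 0%N = 0 -> agree n P f ->
  agree n (\sum_(k < m.+1) (a k)%:P *: P ^+ k) (fps_comp a f).
Proof.
move=> nm f0 Pf i le_in; rewrite coef_sum /fps_comp.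
have P0 : P`_0 = 0 by rewrite Pf.
rewrite [RHS](big_ord_widen m.+1 (fun k => a k *: fps_pow f k i)); last first.
  by rewrite ltnS (leq_trans le_in).
rewrite [RHS]big_mkcond; apply: eq_bigr => k _; rewrite coefZ ltnS.
case: leqP => [ki|ik]; last by rewrite coef_exp_lt ?mulr0.
by rewrite (agree_pow _ Pf) // mul_polyC.
Qed.

(** The derivative of the truncated sum of the P^k / k! is the truncated sum
    with one term less, times P'. *)
Lemma fps_deriv_exp f : f 0%N = 0 ->
  fps_deriv (fps_comp exp_fps f) = fps_mul (fps_comp exp_fps f) (fps_deriv f).
Proof.
move=> f0; apply/funext => n; have F := @fps_truncP _ n.+1 f.
set P := fps_trunc _ _ in F.
have P0 : P`_0 = 0 by rewrite F.
rewrite -(agree_deriv (agree_comp exp_fps (leqnn _) f0 F)) //.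
rewrite -(agree_mul (agree_comp exp_fps (leqnn n) f0 (agree_low _ F)) (agree_deriv F)) //.
suff -> : (\sum_(k < n.+2) (exp_fps k)%:P *: P ^+ k)^`() =
  (\sum_(k < n.+1) (exp_fps k)%:P *: P ^+ k) * P^`() by [].
rewrite (big_morph _ (@derivD _) (@deriv0 _)) big_ord_recl /=.
rewrite expr0 derivZ derivC scaler0 add0r mulr_suml.
apply: eq_bigr => k _; rewrite /bump leq0n add1n derivZ deriv_exp /= -scalerAl mulrC.
rewrite -scaler_nat scalerA; congr (_ *: _).
rewrite -polyC_natr -polyCM; congr (_ %:P).
rewrite /exp_fps factS natrM invfM mulrAC mulVf ?mul1r //.
by rewrite Num.Theory.pnatr_eq0.
Qed.

Lemma fps_sqr_pow k n :
  fps_pow (fun n => (n == 2%N)%:R : {poly rat}) k n = (n == k.*2)%:R.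
Proof.
have X2 m : agree m ('X^2 : {poly {poly rat}}) (fun n => (n == 2%N)%:R).
  by move=> i _; rewrite coefXn.
by rewrite -(agree_pow k (X2 n)) // -exprM coefXn mul2n.
Qed.

Lemma fps_comp_sqr (a : fps rat) n :
  fps_comp a (fun n => (n == 2%N)%:R : {poly rat}) n =
  if odd n then 0 else (a n./2)%:P.
Proof.
rewrite /fps_comp.
under eq_bigr => k _ do rewrite fps_sqr_pow.
case: ifP => n_odd.
  by rewrite big1 // => k _; case: eqP => [E|]; [rewrite E odd_double in n_odd | rewrite scaler0].
have n2 : (n./2 < n.+1)%N by lia.
rewrite (bigD1 (Ordinal n2)) //= big1 ?addr0 => [|k /eqP kn].
  by rewrite even_halfK ?n_odd // eqxx alg_polyC.
case: eqP => [E|]; last by rewrite scaler0.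
by case: kn; apply: val_inj => /=; lia.
Qed.

Lemma binom_fps_rec (c : rat) k :
  binom_fps c k.+1 * k.+1%:R = (c - k%:R) * binom_fps c k.
Proof.
rewrite /binom_fps big_ord_recr /= factS natrM invfM [_^-1 * _]mulrC.
by rewrite [\prod_(_ < _) _ * _]mulrC !mulrA divfK ?Num.Theory.pnatr_eq0.
Qed.

Definition invsqrt_fps : fps {poly rat} :=
  fps_comp (binom_fps (- 2%:R^-1)) (fun n => (n == 2%N)%:R).

(** (1 + t^2) S' = - t S for S = (1 + t^2)^(-1/2), coefficientwise. *)
Lemma invsqrt_fps_ode n : invsqrt_fps n.+2 *+ n.+2 + invsqrt_fps n *+ n = - invsqrt_fps n.
Proof.
rewrite /invsqrt_fps !fps_comp_sqr /= negbK; case: ifP => n_odd.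
  by rewrite !mul0rn oppr0 addr0.
have [k ->] : exists k, n = k.*2 by exists n./2; rewrite even_halfK ?n_odd.
rewrite doubleK -doubleS -!polyCMn -polyCD -polyCN; congr (_%:P).
rewrite -!muln2 !mulrnA -(mulr_natr _ k.+1) binom_fps_rec.
have: - 2%:R^-1 * 2%:R = -1 :> rat by rewrite mulNr mulVf.
move: (- _) (binom_fps _ _) => c b c2.
by rewrite -[RHS]mulN1r -c2 -(mulr_natr b k); ring.
Qed.

Definition arctanX_fps : fps {poly rat} := fun n => arctan_fps n *: 'X.

(** (1 + t^2) (arctan t)' = 1, in the degrees n + 2. *)
Lemma arctanX_fps_ode n :
  arctanX_fps n.+3 *+ n.+3 + arctanX_fps n.+1 *+ n.+1 = 0.
Proof.
rewrite /arctanX_fps !scalerMnl -scalerDl /arctan_fps /= negbK.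
case: (odd n); first by rewrite !mul0rn addr0 scale0r.
have K (x : rat) m : x / m.+1%:R *+ m.+1 = x.
  by rewrite -mulr_natr divfK ?Num.Theory.pnatr_eq0.
by rewrite (K _ n.+2) (K _ n) exprS mulN1r addNr scale0r.
Qed.

Definition exp_arctan_fps : fps {poly rat} := fps_comp exp_fps arctanX_fps.

(** (1 + t^2) F' = (X - t) F: the two factors of F have the logarithmic
    derivatives - t / (1 + t^2) and X / (1 + t^2). *)
Lemma meixner_egf_ode n :
  fps_mul (fun i => (1 + 'X^2 : {poly {poly rat}})`_i) (fps_deriv meixner_egf) n =
  fps_mul (fun i => ('X%:P + (-1) *: 'X : {poly {poly rat}})`_i) meixner_egf n.
Proof.
set U := fun n => _`_n.
pose T : fps {poly rat} := fun n => (0%:P + (-1) *: 'X : {poly {poly rat}})`_n.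
pose C : fps {poly rat} := fun n => ('X%:P + 0 *: 'X : {poly {poly rat}})`_n.
have -> : (fun n => ('X%:P + (-1) *: 'X : {poly {poly rat}})`_n) = fun n => T n + C n.
  by apply/funext => i; rewrite /T /C -coefD polyC0 add0r scale0r addr0 addrC.
have US : fps_mul U (fps_deriv invsqrt_fps) = fps_mul T invsqrt_fps.
  apply/funext => -[|[|i]]; rewrite fps_mul_sqr1 fps_mul_linear /fps_deriv.
  - by rewrite mul0r mulr0 addr0 /invsqrt_fps fps_comp_sqr mul0rn addr0.
  - by rewrite mul0r add0r mulN1r -invsqrt_fps_ode.
  - by rewrite mul0r add0r mulN1r -invsqrt_fps_ode.
have UA : fps_mul U (fps_deriv arctanX_fps) = C.
  apply/funext => -[|[|i]]; rewrite fps_mul_sqr1 /C scale0r !addr0 coefC /fps_deriv /=.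
  - by rewrite /arctanX_fps /arctan_fps /= expr0 divr1 scale1r.
  - by rewrite /arctanX_fps /arctan_fps /= scale0r mul0rn.
  - exact: arctanX_fps_ode.
have UE : fps_mul U (fps_deriv exp_arctan_fps) = fps_mul C exp_arctan_fps.
  rewrite fps_deriv_exp -/exp_arctan_fps; last by rewrite /arctanX_fps scale0r.
  by rewrite (fps_mulC exp_arctan_fps) fps_mulA UA.
have -> : fps_deriv meixner_egf =
    fun n => fps_mul (fps_deriv invsqrt_fps) exp_arctan_fps n +
             fps_mul (fps_deriv exp_arctan_fps) invsqrt_fps n.
  by apply/funext => i; rewrite fps_derivM (fps_mulC (fps_deriv exp_arctan_fps)).
rewrite (fps_mulC U) !fps_mulDl !(fps_mulC _ U) !fps_mulA US UE.
by rewrite -!fps_mulA (fps_mulC exp_arctan_fps).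
Qed.

(** The differential equation read off at t^n / n! is the recurrence
    Q_(n+1) = X Q_n - n^2 Q_(n-1). *)
Lemma meixner_contin n : meixner n = contin 'X (-1) 0 n.
Proof.
(* The coefficient of t^m in the differential equation. *)
have rec m : meixner_egf m.+1 *+ m.+1 = 'X * meixner_egf m -
    (if m is m'.+1 then meixner_egf m' *+ m else 0).
  have := meixner_egf_ode m; rewrite fps_mul_sqr1 fps_mul_linear mulN1r /fps_deriv.
  case: m => [|[|m]] /=.
  - by rewrite oppr0 !addr0.
  - by rewrite addr0.
  - by move=> E; rewrite [in RHS]mulrS opprD addrA -E addrK.
(* The same relation, multiplied by m!. *)
have rec' m : meixner m.+1 = 'X * meixner m - m%:R ^+ 2 * meixner m.-1.
  have fE k : meixner k = meixner_egf k *+ k`!.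
    by rewrite /meixner -mul_polyC polyC_natr mulr_natl.
  rewrite !fE factS mulrnA rec mulrnBl -mulrnAr; congr (_ - _).
  case: m => [|m] /=; first by rewrite mul0rn expr0n mul0r.
  by rewrite factS -mulrnA -natrX mulr_natl -mulrnA; congr (_ *+ _); lia.
have base : meixner 0 = 1.
  rewrite /meixner /meixner_egf /fps_mul big_ord1 /fps_comp !big_ord1.
  rewrite /binom_fps big_ord0 /exp_fps /fps_pow /= /fps_one.
  by rewrite !fact0 divr1 invr1 !scale1r mulr1.
suff [] : meixner n = contin 'X (-1) 0 n /\
         meixner n.+1 = contin 'X (-1) 0 n.+1 by [].
elim: n => [|m [IH IH']]; first by rewrite rec' base /=; split=> //; ring.
by split=> //; rewrite rec' IH' succnK IH continSS add0r mulN1r mulNr.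
Qed.

End FpsComp.

(** * Transfer to the p-adic integers *)

Section Padic.
Variables (p : nat) (p_pr : prime p).

Lemma padic_natE m : m%:R = padic_nat p_pr m :> 'Z_[p_pr].
Proof.
apply: padicP => n; elim: m => [|m IH] //.
by rewrite mulrS /= IH /= modnDmr modnDml add1n.
Qed.

(** The inverse of m is the sequence of the inverses of m modulo the p^n. *)
Lemma padic_nat_unit m : coprime m p -> (m%:R : 'Z_[p_pr]) \is a GRing.unit.
Proof.
move=> mp.
have co n : coprime (p ^ n) m by rewrite coprimeXl // coprime_sym.
pose v n := (chinese (p ^ n) m 1 0 %/ m)%N.
have Ev n : (v n * m = 1 %[mod p ^ n])%N.
  rewrite divnK ?chinese_modl //.
  by rewrite /dvdn chinese_modr // mod0n.
have vP n : (v n.+1 = v n %[mod p ^ n])%N.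
  have Ev1 : (v n.+1 * m = 1 %[mod p ^ n])%N.
    rewrite -(modn_dvdm (v n.+1 * m) (dvdn_exp2l p (leqnSn n))) Ev.
    by rewrite modn_dvdm // dvdn_exp2l.
  (* Modulo p ^ n, both are the product of v n.+1, v n and m. *)
  rewrite -[v n.+1]muln1 -modnMmr -(Ev n) modnMmr.
  by rewrite mulnCA -modnMmr Ev1 modnMmr muln1.
apply/unitrP; exists (padic_of p_pr vP).
suff E : padic_of p_pr vP * m%:R = 1 :> 'Z_[p_pr] by split; rewrite // mulrC.
rewrite padic_natE; apply: padicP => n /=.
by rewrite modnMmr modnMml Ev.
Qed.

(** Congruences between integral polynomials modulo n p need only be checked
    modulo the p-part of n p, the cofactor being a unit of the p-adic integers. *)
Lemma eq_mod_padic_int n (f g : {poly int}) : (0 < n)%N ->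
  eqmod (p ^ (logn p n).+1)%:R f g ->
  eq_mod_padic p_pr (n * p) (map_poly intr f) (map_poly intr g).
Proof.
move=> n_gt0 [h ->].
have [m Em mp] := pfactor_split p_pr n_gt0.
exists (m%:R^-1 *: map_poly intr h).
have m_unit := padic_nat_unit mp.
have intr_tofrac (z : int) : tofrac (z%:~R : 'Z_[p_pr]) = z%:~R by rewrite rmorph_int.
rewrite -rmorphB /= addrC addKr; apply/polyP => k.
rewrite coefZ !coef_map_id0 ?tofrac0 ?raddf0 //; last by rewrite (ratr_int _ 0).
rewrite ratr_int coefZ coef_map /= mulr_natl coefMn rmorphMn /=.
rewrite -intr_tofrac -tofrac1 -!tofracMn -tofracM; congr tofrac.
have {1}-> : (n * p = p ^ (logn p n).+1 * m)%N by rewrite {1}Em expnSr; lia.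
by rewrite mulrA natrM mulrK // mulr_natl.
Qed.
End Padic.

(** * The congruences *)

Theorem mainTheorem3 (p : nat) (p_pr : prime p) (p_neq2 : p <> 2%N)
    (n : nat) (n_gt0 : (0 < n)%N) :
  eq_mod_padic p_pr (n * p) (meixner (n * p)) (meixner p ^+ n) /\
  eq_mod_padic p_pr (n * p) (meixner p ^+ n)
    (('X^p - (-1) ^+ ((p - 1) %/ 2) *: 'X) ^+ n).
Proof.
pose Q m : {poly int} := contin 'X (-1) 0 m.
pose R : {poly int} := 'X^p - (-1) ^+ ((p - 1) %/ 2) *: 'X.
have QE m : meixner m = map_poly intr (Q m).
  rewrite meixner_contin (contin_morph (map_poly intr)) /=.
  by rewrite map_polyX rmorphN rmorph1 rmorph0.
have -> : 'X^p - (-1) ^+ ((p - 1) %/ 2) *: 'X = map_poly intr R :> {poly rat}.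
  rewrite /R rmorphB /= map_polyXn map_polyZ /=.
  by rewrite rmorphXn rmorphN rmorph1 map_polyX.
rewrite !QE -!rmorphXn; split; apply: (eq_mod_padic_int p_pr n_gt0).
  exact: contin_mul_prime.
by apply: (eqmod_exp p_pr n_gt0); apply: contin_prime_int.
Qed.
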